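(* Let $X\subseteq\mathbb{R}^n$ and $Y\subseteq\mathbb{R}^m$ be nonempty, closed and convex, let $O_X\supseteq X$ and $O_Y\supseteq Y$ be open sets, and let $g:\mathbb{R}^n\times\mathbb{R}^m\to\mathbb{R}$ be Lipschitz continuous with $g(x,\cdot)$ convex for each $x\in O_X$. Let $\{g_\mu:\mu>0\}$ be a family of smooth approximations of $g$ over $\mathbb{R}^n\times\mathbb{R}^m$ that satisfies the gradient consistent property. Suppose that: (1) for every open set $\Omega'$ with $\mathrm{cl}(\Omega')\subseteq O_X$ and every $\mu>0$, $g_\mu$ is bounded below on $\mathrm{cl}(\Omega')\times Y$; (2) $g_\mu(x,\cdot)$ is convex for every $x\in O_X$ and $\mu>0$; (3) $(x,y,\mu)\mapsto g_\mu(x,y)$ is continuous on $\mathbb{R}^n\times\mathbb{R}^m\times(0,\infty)$; (4) $g$ is level-bounded in $y$ locally uniformly in $x$; (5) for every open set $\Omega'$ with $\mathrm{cl}(\Omega')\subseteq O_X$, $g_\mu\to g$ uniformly on $\mathrm{cl}(\Omega')\times Y$ as $\mu\searrow0$. Define $v(x)=\min_{y\in Y}g(x,y)$, $S(x)=\operatorname{arg\,min}_{y\in Y}g(x,y)$ and $v_\mu^{\rm quad}(x)=\min_{y\in Y}\big(g_\mu(x,y)+\frac{\mu}{2}\|y\|^2\big)$. Let $\bar x\in O_X$ and suppose that for each $\bar y\in S(\bar x)$ there is a neighborhood $\Theta$ of $(\bar x,\bar y,0)$ such that $\{\nabla g_\mu(x,y):(x,y,\mu)\in\Theta,\ \mu>0\}$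 is bounded. Then, under any one of the following conditions, where $\Omega$ is a neighborhood of $\bar x$, $\{v_\mu^{\rm quad}:\mu>0\}$ is a family of smooth approximations of $v$ (over $O_X$) that satisfies the gradient consistent property at $\bar x$: (a) $\nabla_xg(x,y)$ exists and is continuous on $\Omega\times Y$; (b) there is $\rho>0$ such that $g(\cdot,y)$ is $\rho$-weakly concave on $\Omega$ for all $y\in O_Y$; or (c) $\partial g(\bar x,\bar y)=\partial_xg(\bar x,\bar y)\times\partial_yg(\bar x,\bar y)$ for all $\bar y\in S(\bar x)$, and $g$ is convex in $(x,y)$.
   Context: Smooth approximations: for an open set $O\subseteq\mathbb{R}^d$ and a continuous function $\phi:O\to\mathbb{R}$, $\{\phi_\mu:\mu>0\}$ is a family of smooth approximations of $\phi$ over $O$ if each $\phi_\mu:O\to\mathbb{R}$ is continuously differentiable and for all $\bar z\in O$, $\lim_{z\to\bar z,\ \mu\searrow0}\phi_\mu(z)=\phi(\bar z)$. Such a family satisfies the gradient consistent property at $\bar z\in O$ if $\emptyset\neq\limsup_{z\to\bar z,\mu\searrow0}\nabla\phi_\mu(z)\subseteq\partial\phi(\bar z)$, where the limsup is the set of all $\xi\in\mathbb{R}^d$ for which there exist $z^k\to\bar z$ and $\mu_k\searrow0$ (with $\mu_k>0$) such that $\nabla\phi_{\mu_k}(z^k)\to\xi$; it satisfies the property (without reference to a point) if it does so at every point of $O$. $\partial\phi$ is the Clarke generalized gradient: $\partial\phi(\bar z)=\{\xi:\phi^\circ(\bar z;d)\ge\langle\xi,d\rangle\ \forall d\}$ with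 $\phi^\circ(\bar z;d)=\limsup_{z\to\bar z,\,t\searrow0}\frac{\phi(z+td)-\phi(z)}{t}$. $\partial_xg(\bar x,\bar y)$ and $\partial_yg(\bar x,\bar y)$ are the Clarke generalized gradients of $g(\cdot,\bar y)$ at $\bar x$ and of $g(\bar x,\cdot)$ at $\bar y$. Level-boundedness: for each $x'\in\mathbb{R}^n$ and $M\in\mathbb{R}$ there is an open ball $B$ around $x'$ such that $\{(x,y):x\in B,\ g(x,y)\le M\}$ is bounded. $h$ is $\rho$-weakly concave on a convex set $\Omega$ if $-h+\frac{\rho}{2}\|\cdot\|^2$ is convex on $\Omega$ (so $\Omega$ is understood to be convex in case (b)). $\mathrm{cl}$ denotes closure.
   Formalization: Condition (a) is strengthened: around each point of Ω×Y, ∇_x g exists on a neighborhood in R^n×R^m and is continuous at that point in the whole space; continuity only relative to Ω×Y makes the claim false (g = max(0,|y|−|x|), Y = {0}, shifted mollifications). *)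

(* Defs.v *)
From HB Require Import structures.
From mathcomp Require Import all_boot all_order all_algebra.
From mathcomp Require Import all_classical all_reals all_analysis.
Set Implicit Arguments.
Unset Strict Implicit.
Unset Printing Implicit Defensive.
Import Order.TTheory GRing.Theory Num.Theory.
Import numFieldNormedType.Exports.
Local Open Scope classical_set_scope.
Local Open Scope ring_scope.

(* R^d is 'rV[R]_d and R^n x R^m is 'rV[R]_(n + m), the pair (x, y) being
   row_mx x y.  The library norm on row vectors is the sup norm; it is used
   only for notions that depend on the norm up to equivalence (limits, balls,
   boundedness, Lipschitz continuity).  Euclidean squared norms are written
   dotp y y. *)

Definition dotp (R : realType) (d : nat) (u v : 'rV[R]_d) : R :=
  (u *m v^T) ord0 ord0.

Definition gradient (R : realType) (d : nat) (f : 'rV[R]_d -> R)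
    (z : 'rV[R]_d) : 'rV[R]_d :=
  \row_i 'D_(delta_mx ord0 i) f z.

(* O is meant to be open, so that pointwise continuity at the points of O is
   continuity on O. *)
Definition C1_on (R : realType) (d : nat) (O : set 'rV[R]_d)
    (f : 'rV[R]_d -> R) : Prop :=
  forall z, O z -> differentiable f z /\ {for z, continuous (gradient f)}.

Definition clarke_dd (R : realType) (d : nat) (phi : 'rV[R]_d -> R)
    (z v : 'rV[R]_d) : \bar R :=
  limf_esup (fun p : 'rV[R]_d * R => ((phi (p.1 + p.2 *: v) - phi p.1) / p.2)%:E)
            (filter_prod (nbhs z) (0 : R)^'+).

Definition clarke_subdiff (R : realType) (d : nat) (phi : 'rV[R]_d -> R)
    (z : 'rV[R]_d) : set 'rV[R]_d :=
  [set xi | forall v, ((dotp xi v)%:E <= clarke_dd phi z v)%E].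

(* A function O -> R is a total function of which only the values on O are
   constrained. *)
Definition smooth_approximations (R : realType) (d : nat) (O : set 'rV[R]_d)
    (phi : 'rV[R]_d -> R) (phi_ : R -> 'rV[R]_d -> R) : Prop :=
  [/\ open O,
      (forall z, O z -> {for z, continuous phi}),
      (forall mu, 0 < mu -> C1_on O (phi_ mu)) &
      (forall z, O z ->
        (fun p : 'rV[R]_d * R => phi_ p.2 p.1) @
          filter_prod (nbhs z) (0 : R)^'+ --> phi z)].

Definition limsup_gradient (R : realType) (d : nat)
    (phi_ : R -> 'rV[R]_d -> R) (z : 'rV[R]_d) : set 'rV[R]_d :=
  [set xi | exists (zs : nat -> 'rV[R]_d) (mus : nat -> R),
    [/\ zs @ \oo --> z,
        (forall k, 0 < mus k),
        mus @ \oo --> (0 : R) &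
        (fun k => gradient (phi_ (mus k)) (zs k)) @ \oo --> xi]].

Definition gradient_consistent_at (R : realType) (d : nat)
    (phi : 'rV[R]_d -> R) (phi_ : R -> 'rV[R]_d -> R) (z : 'rV[R]_d) : Prop :=
  limsup_gradient phi_ z !=set0 /\
  limsup_gradient phi_ z `<=` clarke_subdiff phi z.

Definition argmin (R : realType) (T : Type) (A : set T) (f : T -> R) : set T :=
  [set y | A y /\ forall y', A y' -> f y <= f y'].

(* The minimum of f over A; 0 when it is not attained. *)
Definition minval (R : realType) (T : Type) (A : set T) (f : T -> R) : R :=
  xget 0 (f @` argmin A f).

Definition level_bounded (R : realType) (n m : nat)
    (g : 'rV[R]_(n + m) -> R) : Prop :=
  forall (x' : 'rV[R]_n) (M : R), exists2 r : R, 0 < r &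
    bounded_set [set z : 'rV[R]_(n + m) | ball x' r (lsubmx z) /\ g z <= M].

Definition weakly_concave (R : realType) (d : nat) (rho : R)
    (Omega : set 'rV[R]_d) (h : 'rV[R]_d -> R) : Prop :=
  convex_function Omega (fun x => - h x + rho / 2 * dotp x x).

Definition pairs (R : realType) (n m : nat) (A : set 'rV[R]_n)
    (B : set 'rV[R]_m) : set 'rV[R]_(n + m) :=
  [set z | A (lsubmx z) /\ B (rsubmx z)].

Definition gradient_x (R : realType) (n m : nat) (g : 'rV[R]_(n + m) -> R)
    (z : 'rV[R]_(n + m)) : 'rV[R]_n :=
  gradient (fun x => g (row_mx x (rsubmx z))) (lsubmx z).

(* Existence and continuity are meant at each point of D as a point of the
   whole space, not relatively to D: the x-gradient exists around every point
   of D and is continuous there in (x, y).  Continuity relative to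
   Omega x Y would say nothing about g off Y when Y has empty interior, e.g.
   g(x, y) = max(0, |y| - |x|) and Y = {0}, although the gradients of the
   smooth approximations of g do see these values. *)
Definition gradient_x_continuous_on (R : realType) (n m : nat)
    (g : 'rV[R]_(n + m) -> R) (D : set 'rV[R]_(n + m)) : Prop :=
  forall z, D z ->
    (\forall z' \near z,
       differentiable (fun x => g (row_mx x (rsubmx z'))) (lsubmx z')) /\
    {for z, continuous (gradient_x g)}.

Definition optval (R : realType) (n m : nat) (Y : set 'rV[R]_m)
    (g : 'rV[R]_(n + m) -> R) (x : 'rV[R]_n) : R :=
  minval Y (fun y => g (row_mx x y)).

Definition optsol (R : realType) (n m : nat) (Y : set 'rV[R]_m)
    (g : 'rV[R]_(n + m) -> R) (x : 'rV[R]_n) : set 'rV[R]_m :=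
  argmin Y (fun y => g (row_mx x y)).

Definition quad_reg (R : realType) (n m : nat)
    (g_ : R -> 'rV[R]_(n + m) -> R) (mu : R) (z : 'rV[R]_(n + m)) : R :=
  g_ mu z + mu / 2 * dotp (rsubmx z) (rsubmx z).

(* Main.v *)
(** The regularised problem is strongly convex in y, so its minimiser y_mu(x) is
    unique and continuous in x, and by Danskin's argument the gradient of the
    regularised value function is the x-part of the gradient of g_mu at
    (x, y_mu(x)).  Along x_k --> xbar and mu_k --> 0, level-boundedness yields a
    subsequence of y_{mu_k}(x_k) converging to a solution ybar at xbar, and then
    one of the full gradients converging to some (xi, eta) in the Clarke
    subdifferential of g at (xbar, ybar), with <eta, y - ybar> >= 0 on Y by the
    optimality of y_{mu_k}(x_k).  It remains to put xi in the subdifferential of v.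
    In cases (a) and (b), bounding the Clarke derivative of g in the direction
    (d, 0) gives <xi, d> <= (g(xbar, ybar) - g(xbar - t d, ybar)) / t + o(1), and
    the right-hand side is at most (v(xbar) - v(xbar - t d)) / t + o(1).  In case
    (c), (xi, eta) is a convex subgradient of g, so xi is one of v. *)
Require Import Defs.
From HB Require Import structures.
From mathcomp Require Import all_boot all_order all_algebra.
From mathcomp Require Import all_classical all_reals all_analysis.
From mathcomp Require Import ring lra.
Set Implicit Arguments.
Unset Strict Implicit.
Unset Printing Implicit Defensive.
Import Order.TTheory GRing.Theory Num.Theory.
Import numFieldNormedType.Exports.
Local Open Scope classical_set_scope.
Local Open Scope ring_scope.

(** * The Euclidean inner product and the sup norm *)

Section dotp_theory.
Variables (R : realType) (d : nat).
Implicit Types u v w : 'rV[R]_d.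

Lemma dotpE u v : dotp u v = \sum_i u ord0 i * v ord0 i.
Proof. by rewrite /dotp mxE; apply: eq_bigr => i _; rewrite mxE. Qed.

Lemma dotpC u v : dotp u v = dotp v u.
Proof. by rewrite !dotpE; apply: eq_bigr => i _; rewrite mulrC. Qed.

Lemma dotpDl u v w : dotp (u + v) w = dotp u w + dotp v w.
Proof. by rewrite /dotp mulmxDl mxE. Qed.

Lemma dotpZl k u w : dotp (k *: u) w = k * dotp u w.
Proof. by rewrite /dotp -scalemxAl mxE. Qed.

Lemma dotpDr u v w : dotp w (u + v) = dotp w u + dotp w v.
Proof. by rewrite dotpC dotpDl !(dotpC w). Qed.

Lemma dotpZr k u w : dotp w (k *: u) = k * dotp w u.
Proof. by rewrite dotpC dotpZl dotpC. Qed.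

Lemma dotpBl u v w : dotp (u - v) w = dotp u w - dotp v w.
Proof. by rewrite -scaleN1r dotpDl dotpZl mulN1r. Qed.

Lemma dotpBr u v w : dotp w (u - v) = dotp w u - dotp w v.
Proof. by rewrite dotpC dotpBl !(dotpC w). Qed.

Lemma dotp0r u : dotp u 0 = 0.
Proof. by rewrite /dotp trmx0 mulmx0 mxE. Qed.

Lemma dotpDD u v : dotp (u + v) (u + v) = dotp u u + 2 * dotp u v + dotp v v.
Proof. by rewrite dotpDl !dotpDr (dotpC v u); ring. Qed.

Lemma dotp_ge0 u : 0 <= dotp u u.
Proof. by rewrite dotpE; apply: sumr_ge0 => i _; rewrite -expr2 sqr_ge0. Qed.

Lemma dotp_eq0 u : (dotp u u == 0) = (u == 0).
Proof.
apply/eqP/eqP => [|->]; last by rewrite /dotp mul0mx mxE.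
move/eqP; rewrite dotpE psumr_eq0; last by move=> i _; rewrite -expr2 sqr_ge0.
move=> /allP u0; apply/rowP => i; have := u0 i (mem_index_enum i).
by rewrite mxE -expr2 sqrf_eq0 => /eqP.
Qed.

Lemma ler_coord_norm u i : `|u ord0 i| <= `|u|.
Proof.
by rewrite [leRHS]/Num.Def.normr /= mx_normrE; apply/bigmax_geP; right; exists (ord0, i).
Qed.

Lemma ler_norm_coord u e :
  0 <= e -> (forall i, `|u ord0 i| <= e) -> `|u| <= e.
Proof.
move=> e0 ue; rewrite [leLHS]/Num.Def.normr /= mx_normrE; apply/bigmax_leP.
by split=> // -[i j] _; rewrite ord1.
Qed.

Lemma ler_norm_dotp u v : `|dotp u v| <= d%:R * `|u| * `|v|.
Proof.
rewrite dotpE (le_trans (ler_norm_sum _ _ _))//.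
rewrite (@le_trans _ _ (\sum_(i < d) `|u| * `|v|))//; last first.
  by rewrite sumr_const card_ord -mulrA mulr_natl.
by apply: ler_sum => i _; rewrite normrM ler_pM// ler_coord_norm.
Qed.

(** Each squared coordinate is one term of a sum of squares. Bounds on the quadratic regulariser
    thereby become bounds in the sup norm. *)
Lemma sqr_norm_le_dotp u : `|u| ^+ 2 <= dotp u u.
Proof.
have c i : `|u ord0 i| <= Num.sqrt (dotp u u).
  rewrite -(ler_pXn2r (n := 2)) ?nnegrE ?sqrtr_ge0// sqr_sqrtr ?dotp_ge0//.
  rewrite dotpE (bigD1 i)//= real_normK ?num_real// -expr2 lerDl.
  by apply: sumr_ge0 => j _; rewrite -expr2 sqr_ge0.
have := ler_norm_coord (sqrtr_ge0 _) c.
rewrite -(ler_pXn2r (n := 2)) ?nnegrE ?sqrtr_ge0//.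
by rewrite sqr_sqrtr ?dotp_ge0.
Qed.

Lemma cvg_dotp (T : Type) (F : set_system T) {FF : Filter F}
    (f g : T -> 'rV[R]_d) u v :
  f @ F --> u -> g @ F --> v -> (fun x => dotp (f x) (g x)) @ F --> dotp u v.
Proof.
move=> fu gv; rewrite dotpE; under eq_fun do rewrite dotpE.
have: forall s : seq 'I_d, (fun x => \sum_(i <- s) f x ord0 i * g x ord0 i) @ F -->
    \sum_(i <- s) u ord0 i * v ord0 i; last exact.
elim=> [|i s IHs].
  by under eq_fun do rewrite big_nil; rewrite big_nil; exact: cvg_cst.
under eq_fun do rewrite big_cons; rewrite big_cons; apply: cvgD => //.
pose c (w : 'rV[R]_d) := w ord0 i.
have cc w : {for w, continuous c} by exact: coord_continuous.
by apply: cvgM; [exact: (continuous_cvg _ (cc u))|exact: (continuous_cvg _ (cc v))].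
Qed.

Lemma continuous_dotpr u : continuous (dotp u).
Proof.
by move=> v; apply: (@cvg_dotp _ (nbhs v) _ (cst u) id); [exact: cvg_cst|exact: cvg_id].
Qed.

End dotp_theory.

(** * Pairs as concatenated rows: inner products, norms, limits *)

Section row_mx_theory.
Variables (R : realType) (n m : nat).
Implicit Types (x : 'rV[R]_n) (y : 'rV[R]_m) (z : 'rV[R]_(n + m)).

Lemma dotp_row_mx x x' y y' :
  dotp (row_mx x y) (row_mx x' y') = dotp x x' + dotp y y'.
Proof. by rewrite /dotp tr_row_mx mul_row_col mxE. Qed.

Lemma dotp_row_mxl z x : dotp z (row_mx x 0) = dotp (lsubmx z) x.
Proof. by rewrite -{1}[z]hsubmxK dotp_row_mx dotp0r addr0. Qed.

Lemma dotp_row_mxr z y : dotp z (row_mx 0 y) = dotp (rsubmx z) y.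
Proof. by rewrite -{1}[z]hsubmxK dotp_row_mx dotp0r add0r. Qed.

Lemma norm_row_mx x y : `|row_mx x y| = Num.max `|x| `|y|.
Proof.
apply/eqP; rewrite eq_le ge_max; apply/and3P; split.
- apply: ler_norm_coord => [|i]; first by rewrite le_max normr_ge0.
  by rewrite mxE; case: splitP => j _; rewrite le_max ler_coord_norm ?orbT.
- apply: ler_norm_coord => // i; apply: le_trans (ler_coord_norm _ (lshift m i)).
  by rewrite row_mxEl.
- apply: ler_norm_coord => // i; apply: le_trans (ler_coord_norm _ (rshift n i)).
  by rewrite row_mxEr.
Qed.

Lemma cvg_row_mx (T : Type) (F : set_system T) {FF : Filter F}
    (f : T -> 'rV[R]_n) (g : T -> 'rV[R]_m) x y :
  f @ F --> x -> g @ F --> y -> (fun t => row_mx (f t) (g t)) @ F --> row_mx x y.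
Proof.
move=> /cvgrPdist_lt fx /cvgrPdist_lt gy; apply/cvgrPdist_lt => e e0.
near=> t; rewrite opp_row_mx add_row_mx norm_row_mx gt_max.
by apply/andP; split; near: t; [exact: fx|exact: gy].
Unshelve. all: by end_near. Qed.

Lemma norm_lsubmx (z : 'rV[R]_(n + m)) : `|lsubmx z| <= `|z|.
Proof. by rewrite -{2}[z]hsubmxK norm_row_mx le_max lexx. Qed.

Lemma norm_rsubmx (z : 'rV[R]_(n + m)) : `|rsubmx z| <= `|z|.
Proof. by rewrite -{2}[z]hsubmxK norm_row_mx le_max lexx orbT. Qed.

Lemma cvg_lsubmx (T : Type) (F : set_system T) {FF : Filter F}
    (f : T -> 'rV[R]_(n + m)) (z : 'rV[R]_(n + m)) :
  f @ F --> z -> (fun t => lsubmx (f t)) @ F --> lsubmx z.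
Proof. by move=> fz; exact: (continuous_cvg _ (@continuous_lsubmx _ _ _ _ z)). Qed.

Lemma cvg_rsubmx (T : Type) (F : set_system T) {FF : Filter F}
    (f : T -> 'rV[R]_(n + m)) (z : 'rV[R]_(n + m)) :
  f @ F --> z -> (fun t => rsubmx (f t)) @ F --> rsubmx z.
Proof. by move=> fz; exact: (continuous_cvg _ (@continuous_rsubmx _ _ _ _ z)). Qed.

End row_mx_theory.

(** * Gradients as representatives of differentials *)

Section dotp_linear.
Variables (R : realType) (d : nat) (u : 'rV[R]_d).

Let dotp_linear : linear (dotp u : 'rV[R]_d -> R^o).
Proof. by move=> k v w; rewrite dotpDr dotpZr. Qed.

HB.instance Definition _ := GRing.isLinear.Build R 'rV[R]_d R^o _ (dotp u) dotp_linear.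

End dotp_linear.

Section gradient_theory.
Variables (R : realType) (d : nat).
Implicit Types (f : 'rV[R]_d -> R) (u v w z : 'rV[R]_d).

Lemma diff_gradient f z v : differentiable f z -> 'd f z v = dotp (gradient f z) v.
Proof.
move=> df; rewrite {1}[v]row_sum_delta linear_sum dotpE; apply: eq_bigr => i _.
by rewrite linearZ mxE deriveE// [RHS]mulrC.
Qed.

Lemma differentiableP_gradient f z u :
  (forall e, 0 < e -> \forall x \near z,
     `|f x - f z - dotp u (x - z)| <= e * `|x - z|) ->
  differentiable f z /\ gradient f z = u.
Proof.
move=> fu.
have cu : continuous (dotp u : 'rV[R]_d -> R^o) by exact: continuous_dotpr.
have E : f \o shift z = cst (f z) + (dotp u : 'rV[R]_d -> R^o) +o_ (0 : 'rV[R]_d) id.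
  apply/eqaddoP => e e0; rewrite !near_simpl /=.
  have := fu e e0; rewrite (near_shift 0 z).
  apply: filterS => x /=; rewrite subr0 addrK !fctE /=.
  by rewrite opprD addrA.
have dE : 'd f z = dotp u :> ('rV[R]_d -> R) by exact: (@diff_unique _ _ _ f (dotp u) z).
have df : differentiable f z by apply/diff_locallyP; rewrite dE.
split=> //; apply/rowP => i; rewrite mxE deriveE// dE dotpE (bigD1 i)//= big1 ?addr0.
  by rewrite mxE !eqxx mulr1.
by move=> j ji; rewrite mxE (negbTE ji) andbF mulr0.
Qed.

(** The scalar mean value theorem on [0, 1] for [s] |-> [f (z + s *: w)], whose derivative is given
    by the gradient. *)
Lemma MVT_line f z w :
  (forall s : R, 0 <= s <= 1 -> differentiable f (z + s *: w)) ->
  exists2 s, 0 < s < 1 & f (z + w) - f z = dotp (gradient f (z + s *: w)) w.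
Proof.
move=> df; pose phi (s : R) : R := f (z + s *: w).
have dphi (s : R) : 0 <= s <= 1 -> is_derive s 1 phi (dotp (gradient f (z + s *: w)) w).
  move=> s01.
  have E : (fun h => h^-1 *: ((phi \o shift s) (h *: 1) - phi s)) =
      (fun h => h^-1 *: ((f \o shift (z + s *: w)) (h *: w) - f (z + s *: w))).
    by apply/funext => h; rewrite /phi /= [h *: 1]mulr1 scalerDl addrCA.
  have /df dfs := s01.
  apply: DeriveDef; first by rewrite /derivable E; exact: diff_derivable.
  by rewrite /derive E -/(derive _ _ _) deriveE// diff_gradient.
have [] := @MVT _ phi (fun s : R => dotp (gradient f (z + s *: w)) w) 0 1 ltr01.
- by move=> s; rewrite in_itv /= => /andP[s0 s1]; apply: dphi; rewrite !ltW.
- apply: derivable_within_continuous => s; rewrite in_itv /= => /dphi ds.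
  exact: ex_derive.
move=> s; rewrite in_itv /= => s01; rewrite /phi scale1r scale0r addr0 subr0 mulr1.
by move=> E; exists s.
Qed.

End gradient_theory.

(** * Subsequences, compactness and existence of minimisers *)

Section sequences.
Variable R : realType.

(** Index maps with [k <= f k] serve as subsequences throughout; tending to infinity suffices for
    passing to limits, so strict monotonicity is not asked for. *)
Lemma cvg_ge_id (f : nat -> nat) : (forall k, (k <= f k)%N) -> f @ \oo --> \oo.
Proof.
move=> kf A [N _ NA]; exists N => // k /= Nk.
by apply: NA => /=; exact: leq_trans (kf k).
Qed.

Lemma bounded_subsequence d (u : nat -> 'rV[R]_d) (M : R) :
  (\forall k \near \oo, `|u k| <= M) ->
  exists f (p : 'rV[R]_d), (forall k, (k <= f k)%N) /\ u \o f @ \oo --> p.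
Proof.
move=> uM; pose A := [set v : 'rV[R]_d | `|v| <= M].
have cA : compact A.
  apply: bounded_closed_compact.
    by exists M; split=> [|N MN v /le_trans]; [exact: num_real|apply; exact: ltW].
  exact: (closed_comp (fun v _ => @norm_continuous _ _ v) (@closed_le _ M)).
have [p [_ clp]] := cA (u @ \oo) _ uM.
(* The cluster point [p] meets every tail of [u] in every ball; the [k]-th index is picked in the
   tail from [k] and the ball of radius 1/(k+1). *)
have /choice[f fP] k : exists j, (k <= j)%N /\ `|p - u j| < k.+1%:R^-1.
  have [] := clp [set u j | j in [set j | (k <= j)%N]] (ball p k.+1%:R^-1).
  - by exists k => // j kj; exists j.
  - by apply: nbhsx_ballx; rewrite invr_gt0.
  by move=> _ [[j kj <-]]; rewrite -ball_normE /= => pj; exists j.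
exists f, p; split=> [k|]; first by have [] := fP k.
apply/cvgrPdist_lt => e e0; near=> k.
have [_ /lt_trans] := fP k; apply.
by near: k; exact: near_infty_natSinv_lt (PosNum e0).
Unshelve. all: by end_near. Qed.

(** By contradiction: if [F] is discontinuous at [x], points within 1/(k+1) of [x] with values at
    distance at least [e] from [F x] form a sequence no subsequence of which has the required
    limit. *)
Lemma subsequence_continuous (V W : normedModType R) (F : V -> W) (x : V) :
  (forall u : nat -> V, u @ \oo --> x ->
    exists2 f, (forall k, (k <= f k)%N) & F \o (u \o f) @ \oo --> F x) ->
  {for x, continuous F}.
Proof.
move=> Fu; apply/cvgrPdist_lt => e e0; apply: contrapT => nF.
have /choice[u uP] k : exists z, `|x - z| < k.+1%:R^-1 /\ e <= `|F x - F z|.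
  apply: contrapT => /forallNP nz; apply: nF.
  have k0 : 0 < k.+1%:R^-1 :> R by rewrite invr_gt0.
  have := nbhsx_ballx x _ k0; apply: filterS => z; rewrite -ball_normE /= => xz.
  by rewrite ltNge; apply/negP => eF; exact: (nz z).
have [|f kf] := Fu u.
  apply/cvgrPdist_lt => r r0; near=> k; have [/lt_trans + _] := uP k; apply.
  by near: k; exact: near_infty_natSinv_lt (PosNum r0).
move=> /cvgrPdist_lt /(_ e e0) [N _ /(_ N (leqnn N))] /=.
by rewrite ltNge; have [_ ->] := uP (f N).
Unshelve. all: by end_near. Qed.

(** The part of [Y] where [f] is at most [f y0] is compact, and a minimiser there is a minimiser
    over [Y]. *)
Lemma argmin_nonempty d (Y : set 'rV[R]_d) (f : 'rV[R]_d -> R) y0 (M : R) :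
  closed Y -> continuous f -> Y y0 ->
  (forall y, Y y -> f y <= f y0 -> `|y| <= M) -> argmin Y f !=set0.
Proof.
move=> cY cf Yy0 yM; pose A := Y `&` [set y | f y <= f y0].
have cA : compact A.
  apply: bounded_closed_compact.
    exists M; split=> [|N MN y [Yy fy]]; first exact: num_real.
    exact: le_trans (yM _ Yy fy) (ltW MN).
  by apply: closedI => //; exact: (closed_comp (fun v _ => cf v) (@closed_le _ (f y0))).
have [||y yA ymin] := @compact_EVT_min _ _ f A _ cA.
- by exists y0; split => //=.
- exact: continuous_subspaceT.
move: yA; rewrite inE => -[Yy fy]; exists y; split=> // y' Yy'.
have [y'y0|/ltW y0y'] := leP (f y') (f y0); last exact: le_trans y0y'.
by apply: ymin; rewrite inE.
Qed.

End sequences.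

(** * Differentiation of a value function *)

Section danskin.
Variables (R : realType) (n m : nat).

(* Each increment of v is squeezed between two increments of h in the
   x-direction at nearby points, to which the mean value theorem applies. *)
Lemma danskin (h : 'rV[R]_(n + m) -> R) (v : 'rV[R]_n -> R)
    (y : 'rV[R]_n -> 'rV[R]_m) x0 :
  (forall z, differentiable h z) ->
  {for row_mx x0 (y x0), continuous (gradient h)} ->
  {for x0, continuous y} ->
  (\forall x \near x0,
    v x - v x0 <= h (row_mx x (y x0)) - h (row_mx x0 (y x0)) /\
    h (row_mx x (y x)) - h (row_mx x0 (y x)) <= v x - v x0) ->
  differentiable v x0 /\ gradient v x0 = lsubmx (gradient h (row_mx x0 (y x0))).
Proof.
move=> dh cG cy hv; set G := gradient h (row_mx x0 (y x0)).
apply: differentiableP_gradient => e e0.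
(* Bounding an inner product by sup norms costs a factor [n]; dividing by [n.+1] absorbs it and also
   covers [n = 0]. *)
have c0 : 0 < e / n.+1%:R by rewrite divr_gt0.
have /cvgrPdist_lt/(_ _ c0)/nbhs_ballP[r /= r0 rG] := cG.
have key x y' : `|x0 - x| < r -> `|y x0 - y'| < r ->
    `|h (row_mx x y') - h (row_mx x0 y') - dotp (lsubmx G) (x - x0)| <= e * `|x - x0|.
  move=> xr yr.
  have [|s /andP[s0 s1]] := @MVT_line _ _ h (row_mx x0 y') (row_mx (x - x0) 0).
    by move=> s _; exact: dh.
  rewrite add_row_mx addr0 [x0 + _]addrC subrK => ->.
  set G' := gradient _ _.
  rewrite -dotp_row_mxl -dotpBl dotp_row_mxl (le_trans (ler_norm_dotp _ _))//.
  rewrite ler_wpM2r// (@le_trans _ _ (n%:R * (e / n.+1%:R)))//.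
    rewrite ler_wpM2l// (le_trans (norm_lsubmx _))// distrC ltW//; apply: rG.
    rewrite -ball_normE /= scale_row_mx add_row_mx opp_row_mx add_row_mx norm_row_mx.
    rewrite scaler0 addr0 gt_max yr andbT opprD addrA subrr add0r normrN normrZ.
    rewrite gtr0_norm// distrC (le_lt_trans _ xr)// distrC ler_piMl//; exact: ltW.
  by rewrite mulrCA ger_pMr// ler_pdivrMr// mul1r ler_nat.
near=> x.
have xr : `|x0 - x| < r by near: x; exact: (@cvgr_dist_lt _ _ _ _ _ id x0 _ r r0).
have yr : `|y x0 - y x| < r by near: x; exact: (@cvgr_dist_lt _ _ _ _ _ y (y x0)).
have [v1 v2] : v x - v x0 <= h (row_mx x (y x0)) - h (row_mx x0 (y x0)) /\
    h (row_mx x (y x)) - h (row_mx x0 (y x)) <= v x - v x0 by near: x.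
have := key x (y x) xr yr; have := key x (y x0) xr.
rewrite subrr normr0 => /(_ r0); rewrite !ler_norml => /andP[k1 k2] /andP[k3 k4].
by apply/andP; split; lra.
Unshelve. all: by end_near. Qed.

End danskin.

(** * Clarke derivatives and subgradients *)

Lemma near_fst (T U : Type) (F : set_system T) (G : set_system U) (P : set T) :
  Filter F -> Filter G -> F P -> filter_prod F G (fun p => P p.1).
Proof. by move=> FF FG; exact: (@cvg_fst _ _ F G FG P). Qed.

Lemma near_snd (T U : Type) (F : set_system T) (G : set_system U) (P : set U) :
  Filter F -> Filter G -> G P -> filter_prod F G (fun p => P p.2).
Proof. by move=> FF FG; exact: (@cvg_snd _ _ F G FF P). Qed.

Section clarke_theory.
Variables (R : realType) (d : nat).
Implicit Types (phi : 'rV[R]_d -> R) (z v xi : 'rV[R]_d).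

Lemma clarke_subdiff_le phi z xi v (b : R) : clarke_subdiff phi z xi ->
  (\forall p \near filter_prod (nbhs z) (0 : R)^'+,
    (phi (p.1 + p.2 *: v) - phi p.1) / p.2 <= b) ->
  dotp xi v <= b.
Proof.
move=> /(_ v) xiv phib; rewrite -lee_fin (le_trans xiv)//.
apply: ge_ereal_inf.
exists (ereal_sup ((fun p => ((phi (p.1 + p.2 *: v) - phi p.1) / p.2)%:E) @`
  [set p | (phi (p.1 + p.2 *: v) - phi p.1) / p.2 <= b])).
  by eexists; first exact: phib.
by apply: ge_ereal_sup => _ [p pb <-]; rewrite lee_fin.
Qed.

(** The pair ([p t], [t]) eventually enters every set of the product filter, so difference quotients
    along a single path bound the limsup from below. *)
Lemma clarke_dd_ge phi z v (a : R) (p : R -> 'rV[R]_d) :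
  p @ (0 : R)^'+ --> z ->
  (forall e, 0 < e -> \forall t \near (0 : R)^'+,
    a - e <= (phi (p t + t *: v) - phi (p t)) / t) ->
  (a%:E <= clarke_dd phi z v)%E.
Proof.
move=> pz ap; apply/lee_subgt0Pr => e e0; apply: le_ereal_inf_tmp => _ [V VF <-].
have Vp : \forall t \near (0 : R)^'+, V (p t, t).
  apply: (@cvg_pair _ _ _ (0 : R)^'+ (nbhs z) (0 : R)^'+ _ _ _ p id pz);
    [exact: cvg_id|exact: VF].
have [t [Vt ha]] : exists t, V (p t, t) /\ a - e <= (phi (p t + t *: v) - phi (p t)) / t.
  by apply: (@filter_ex _ (0 : R)^'+); exact: filterI Vp (ap e e0).
apply: (@le_trans _ _ ((phi (p t + t *: v) - phi (p t)) / t)%:E).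
  by rewrite lee_fin.
by apply: ereal_sup_ubound; exists (p t, t).
Qed.

Lemma cvg_line z v : (fun t : R => z + t *: v) @ (0 : R)^'+ --> z.
Proof.
rewrite -[X in _ --> X]addr0 -(scale0r v); apply: cvg_at_right_filter.
apply: cvgD; first exact: cvg_cst.
exact: (@cvgZr_tmp _ _ _ (nbhs 0) _ id 0 v cvg_id).
Qed.

(** A local affine minorant touching at [z] bounds the quotients based at [z] itself, so the
    constant path suffices. *)
Lemma clarke_subdiff_convex phi z xi :
  (\forall x \near z, phi z + dotp xi (x - z) <= phi x) ->
  clarke_subdiff phi z xi.
Proof.
move=> phix v; apply: (@clarke_dd_ge _ _ _ _ (cst z)); first exact: cvg_cst.
move=> e e0.
have zt := @cvg_line z v.
near=> t.
have t0 : 0 < t by [].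
have : phi z + dotp xi (z + t *: v - z) <= phi (z + t *: v).
  by near: t; exact: (zt _ phix).
rewrite addrAC subrr add0r dotpZr ler_pdivlMr// => h.
by rewrite mulrBl (le_trans (y := dotp xi v * t))// ?lerBlDl ?lerDr; nra.
Unshelve. all: by end_near. Qed.

(* Approaching z along z - t v turns the decrements of a majorant of phi which
   touches it at z into increments of phi. *)
Lemma clarke_subdiff_touching_above phi psi z xi :
  (\forall x \near z, phi x <= psi x) -> phi z = psi z ->
  (forall v e, 0 < e -> \forall t \near (0 : R)^'+,
    dotp xi v - e <= (psi z - psi (z - t *: v)) / t) ->
  clarke_subdiff phi z xi.
Proof.
move=> phipsi phiz psit v.
have zt : (fun t : R => z - t *: v) @ (0 : R)^'+ --> z.
  by have := @cvg_line z (- v); under eq_fun do rewrite scalerN.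
apply: (clarke_dd_ge zt) => e e0; near=> t.
have t0 : 0 < t by [].
have /le_trans : dotp xi v - e <= (psi z - psi (z - t *: v)) / t.
  by near: t; exact: psit.
apply; rewrite ler_pM2r ?invr_gt0// subrK phiz lerB//.
by near: t; exact: (zt _ phipsi).
Unshelve. all: by end_near. Qed.

Lemma convex_functionP (D : set 'rV[R]_d) phi (l : R) x y :
  convex_function D phi -> D x -> D y -> 0 <= l <= 1 ->
  phi (l *: x + (1 - l) *: y) <= l * phi x + (1 - l) * phi y.
Proof.
move=> cphi Dx Dy /andP[l0 l1].
by have := cphi (Itv01 l0 l1) x y; rewrite !inE => /(_ Dx Dy).
Qed.

(** For a concave function forward slopes are at most backward slopes. Here [x] is the convex
    combination of [x - s *: v] and [x + t *: v] with weight [t / (s + t)] on the former, and the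
    quadratic terms collapse to the stated error. *)
Lemma weakly_concave_slope rho (Omega : set 'rV[R]_d) phi x v (s t : R) :
  weakly_concave rho Omega phi -> 0 < s -> 0 < t ->
  Omega (x - s *: v) -> Omega (x + t *: v) ->
  (phi (x + t *: v) - phi x) / t <=
  (phi x - phi (x - s *: v)) / s + rho / 2 * (s + t) * dotp v v.
Proof.
move=> wc s0 t0 Os Ot.
have st0 : 0 < s + t by rewrite addr_gt0.
have stn : s + t != 0 by rewrite gt_eqF.
have [l lE l01] : exists2 l, l * (s + t) = t & 0 <= l <= 1.
  exists (t / (s + t)); first by rewrite divfK.
  by rewrite divr_ge0 ?(ltW t0) ?(ltW st0)//= ler_pdivrMr// mul1r lerDr ltW.
have := convex_functionP wc Os Ot l01.
have -> : l *: (x - s *: v) + (1 - l) *: (x + t *: v) = x.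
  rewrite !scalerDr scalerBl scale1r scalerN !scalerA addrACA subrKC.
  rewrite -scaleNr -scalerDl [X in X *: v](_ : _ = 0) ?scale0r ?addr0//.
  by lra.
rewrite !dotpBl !dotpBr !dotpDl !dotpDr !dotpZl !dotpZr (dotpC v x).
set A := phi x; set B := phi _; set C := phi _; set N := dotp x x.
set P := dotp x v; set Q := dotp v v => H.
rewrite ler_pdivrMr// -(ler_pM2r s0) mulrDl.
have -> : ((A - B) / s + rho / 2 * (s + t) * Q) * t * s =
    (A - B) * t + rho / 2 * (s + t) * Q * t * s.
  by field; rewrite gt_eqF.
have {}H := ler_wpM2r (ltW st0) H.
have E1 : (l * (- B + rho / 2 * (N - s * P - (s * P - s * (s * Q)))) +
  (1 - l) * (- C + rho / 2 * (N + t * P + (t * P + t * (t * Q))))) * (s + t) =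
  (l * (s + t)) * (- B + rho / 2 * (N - s * P - (s * P - s * (s * Q)))) +
  ((s + t) - l * (s + t)) * (- C + rho / 2 * (N + t * P + (t * P + t * (t * Q)))).
  by ring.
move: H; rewrite E1 lE; lra.
Qed.

(** By convexity a quotient with step at most 1 in the direction [x - z] is bounded by the full
    increment from its base point, and this increment depends continuously on the base point. *)
Lemma clarke_subdiff_convex_ge phi z xi x :
  convex_function setT phi -> continuous phi -> clarke_subdiff phi z xi ->
  phi z + dotp xi (x - z) <= phi x.
Proof.
move=> cphi ctphi xiz; rewrite -lerBrDl; apply/ler_addgt0Pr => e e0.
apply: (clarke_subdiff_le xiz).
have ct : (fun z' => phi (z' + (x - z)) - phi z') @ nbhs z --> phi x - phi z.
  apply: cvgB; last exact: ctphi.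
  have zx : (fun z' => z' + (x - z)) @ nbhs z --> x.
    by rewrite -[X in _ --> X](subrKC z); apply: cvgD; [exact: cvg_id|exact: cvg_cst].
  exact: (continuous_cvg _ (ctphi x) zx).
have cte : \forall z' \near z, phi (z' + (x - z)) - phi z' <= phi x - phi z + e.
  have /cvgrPdist_le/(_ _ e0) := ct; apply: filterS => z' /=.
  by rewrite ler_norml => /andP[? ?]; lra.
near=> p.
have t0 : 0 < p.2 by near: p; exact: (near_snd _ _ (nbhs_right_gt 0)).
have t1 : p.2 <= 1 by near: p; exact: (near_snd _ _ (nbhs_right_le ltr01)).
have : phi (p.1 + (x - z)) - phi p.1 <= phi x - phi z + e.
  by near: p; exact: (near_fst _ _ cte).
apply: le_trans; rewrite ler_pdivrMr//.
have := @convex_functionP _ phi p.2 (p.1 + (x - z)) p.1 cphi I I.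
rewrite (ltW t0) t1 => /(_ isT).
by rewrite scalerDr addrAC -scalerDl subrKC scale1r; lra.
Unshelve. all: by end_near. Qed.

End clarke_theory.

(** * Clarke subgradients and backward slopes in [x] *)

Section partial_clarke.
Variables (R : realType) (n m : nat) (g : 'rV[R]_(n + m) -> R).
Implicit Types (z zeta : 'rV[R]_(n + m)) (v : 'rV[R]_n).

Let slice z := fun x => g (row_mx x (rsubmx z)).

Let row_mx_shift z t v :
  row_mx (lsubmx z + t *: v) (rsubmx z) = z + t *: row_mx v 0.
Proof. by rewrite -{3}[z]hsubmxK scale_row_mx scaler0 add_row_mx addr0. Qed.

Lemma slice_shift z t v : slice z (lsubmx z - t *: v) = g (z - t *: row_mx v 0).
Proof. by rewrite /slice -scaleNr row_mx_shift scaleNr. Qed.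

(** Strict differentiability in the direction ([v], 0): by the mean value theorem each quotient is
    the inner product of [v] with [gradient_x g] at a point near [z]. *)
Lemma strict_gradient_x z v :
  (\forall z' \near z,
    differentiable (fun x => g (row_mx x (rsubmx z'))) (lsubmx z')) ->
  {for z, continuous (gradient_x g)} ->
  forall e, 0 < e -> \forall p \near filter_prod (nbhs z) (0 : R)^'+,
    `|(g (p.1 + p.2 *: row_mx v 0) - g p.1) / p.2 - dotp (gradient_x g z) v| <= e.
Proof.
move=> dg cg e e0.
have k0 : 0 < n%:R * `|v| + 1 by rewrite ltr_wpDl// mulr_ge0.
have /cvgrPdist_lt/(_ _ (divr_gt0 e0 k0)) := cg.
move=> /(filterI dg) /nbhs_ballP[r /= r0 rg].
have v0 : 0 < `|v| + 1 by rewrite ltr_wpDl.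
have r20 : 0 < r / 2 by rewrite divr_gt0.
(* Steps below this bound move a base point in the ball of radius [r / 2] by less than [r / 2], so
   the whole segment stays in the ball of radius [r]. *)
have tr0 : 0 < r / 2 / (`|v| + 1) by rewrite divr_gt0.
near=> p.
have t0 : 0 < p.2.
  by near: p; exact: (near_snd _ _ (nbhs_right_gt 0)).
have tr : p.2 < r / 2 / (`|v| + 1).
  by near: p; exact: (near_snd _ _ (nbhs_right_lt tr0)).
have zr : ball z (r / 2) p.1.
  by near: p; exact: (near_fst _ _ (nbhsx_ballx z _ r20)).
have seg s : 0 <= s <= 1 -> ball z r (p.1 + (s * p.2) *: row_mx v 0).
  move=> /andP[s0 s1]; rewrite (splitr r); apply: (ball_triangle zr).
  rewrite -ball_normE /= opprD addNKr normrN normrZ norm_row_mx normr0.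
  rewrite (max_idPl _)// ger0_norm ?mulr_ge0 ?(ltW t0)//.
  rewrite ltr_pdivlMr// in tr.
  have tv : 0 <= p.2 * `|v| by rewrite mulr_ge0// ltW.
  rewrite -mulrA (le_lt_trans (ler_piMl tv s1))//.
  by apply: le_lt_trans tr; rewrite ler_pM2l// lerDl.
have [s s01|s /andP[s0 s1]] := @MVT_line _ _ (slice p.1) (lsubmx p.1) (p.2 *: v).
  have [/= + _] := rg _ (seg _ s01).
  by rewrite scalerA -row_mx_shift row_mxKr row_mxKl.
rewrite scalerA {1 2}/slice row_mx_shift hsubmxK => ->.
have -> : gradient (slice p.1) (lsubmx p.1 + (s * p.2) *: v) =
    gradient_x g (p.1 + (s * p.2) *: row_mx v 0).
  by rewrite -row_mx_shift /gradient_x row_mxKr row_mxKl.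
have [|_ /= sg] := rg (p.1 + (s * p.2) *: row_mx v 0).
  by apply: seg; rewrite !ltW.
rewrite dotpZr mulrAC mulfV ?gt_eqF// mul1r -dotpBl.
rewrite (le_trans (ler_norm_dotp _ _))// distrC.
move: sg; rewrite ltr_pdivlMr//; set q := `|_ - _| => sg.
have q0 : 0 <= q by exact: normr_ge0.
by rewrite mulrAC mulrC; apply: le_trans (ltW sg); rewrite ler_wpM2l// lerDl.
Unshelve. all: by end_near. Qed.

(** Strict differentiability is used twice, with error [e / 2] each: at all base points near [z], to
    bound the Clarke derivative, and at the base points [z - t *: row_mx v 0], to compare with
    backward slopes. *)
Lemma clarke_gradient_x z zeta v :
  (\forall z' \near z,
    differentiable (fun x => g (row_mx x (rsubmx z'))) (lsubmx z')) ->
  {for z, continuous (gradient_x g)} ->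
  clarke_subdiff g z zeta ->
  forall e, 0 < e -> \forall t \near (0 : R)^'+,
    dotp (lsubmx zeta) v - e <=
    (slice z (lsubmx z) - slice z (lsubmx z - t *: v)) / t.
Proof.
move=> dg cg zetaz e e0; have e20 : 0 < e / 2 by rewrite divr_gt0.
have strict := strict_gradient_x v dg cg e20.
have xi_le : dotp (lsubmx zeta) v <= dotp (gradient_x g z) v + e / 2.
  rewrite -dotp_row_mxl; apply: (clarke_subdiff_le zetaz).
  by apply: filterS strict => p; rewrite ler_norml => /andP[? ?]; lra.
have zt : (fun t : R => z - t *: row_mx v 0) @ (0 : R)^'+ --> z.
  by have := @cvg_line _ _ z (- row_mx v 0); under eq_fun do rewrite scalerN.
have ptt : (fun t : R => (z - t *: row_mx v 0, t)) @ (0 : R)^'+ -->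
    filter_prod (nbhs z) (0 : R)^'+ by
  apply: (@cvg_pair _ _ _ (0 : R)^'+ (nbhs z) (0 : R)^'+ _ _ _ _ id zt); exact: cvg_id.
near=> t.
have : `|(g (z - t *: row_mx v 0 + t *: row_mx v 0) - g (z - t *: row_mx v 0)) / t -
    dotp (gradient_x g z) v| <= e / 2 by near: t; exact: (ptt _ strict).
rewrite slice_shift /slice hsubmxK subrK.
by rewrite ler_norml => /andP[? ?]; lra.
Unshelve. all: by end_near. Qed.

(** For a fixed small [s], forward slopes at base points near [z] are bounded by backward slopes of
    length [s], which are continuous in the base point. The base points also vary in [y], hence weak
    concavity for all [y] in a neighbourhood. *)
Lemma clarke_weakly_concave (Omega : set 'rV[R]_n) (OY : set 'rV[R]_m) rho z zeta v :
  nbhs (lsubmx z) Omega -> nbhs (rsubmx z) OY -> continuous g -> 0 < rho ->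
  (forall y, OY y -> weakly_concave rho Omega (fun x => g (row_mx x y))) ->
  clarke_subdiff g z zeta ->
  forall e, 0 < e -> \forall t \near (0 : R)^'+,
    dotp (lsubmx zeta) v - e <=
    (slice z (lsubmx z) - slice z (lsubmx z - t *: v)) / t.
Proof.
move=> zO zOY cg rho0 wc zetaz e e0.
have lz : (fun w => lsubmx w) @ nbhs z --> lsubmx z.
  exact: continuous_lsubmx.
have rz : (fun w => rsubmx w) @ nbhs z --> rsubmx z.
  exact: continuous_rsubmx.
have Q0 : 0 < rho * (dotp v v + 1) by rewrite mulr_gt0// ltr_wpDl// dotp_ge0.
have e20 : 0 < e / 2 by rewrite divr_gt0.
(* For [s] below this bound and forward steps shorter than [s], the weak concavity error is at most
   [e / 2]. *)
have es0 : 0 < e / 2 / (rho * (dotp v v + 1)) by rewrite divr_gt0.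
(* The interior leaves room for the base point to vary once [s] is fixed. *)
have Os : \forall s \near (0 : R)^'+, Omega^° (lsubmx z + s *: - v).
  exact: (@cvg_line _ _ (lsubmx z) (- v) _ (nbhs_interior zO)).
near=> s.
have s0 : 0 < s by [].
have Osz : Omega^° (lsubmx z + s *: - v) by near: s.
have se : s < e / 2 / (rho * (dotp v v + 1)) by near: s; exact: nbhs_right_lt.
have ct : (fun w => (g w - g (w - s *: row_mx v 0)) / s) @ nbhs z -->
    (g z - g (z - s *: row_mx v 0)) / s.
  apply: cvgM; last exact: cvg_cst.
  apply: cvgB; first exact: cg.
  have zs : (fun w => w - s *: row_mx v 0) @ nbhs z --> z - s *: row_mx v 0.
    by apply: cvgB; [exact: cvg_id|exact: cvg_cst].
  exact: (continuous_cvg _ (cg _) zs).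
rewrite slice_shift {1}/slice hsubmxK lerBlDr -dotp_row_mxl.
apply: (clarke_subdiff_le zetaz).
have cte : \forall w \near z,
    (g w - g (w - s *: row_mx v 0)) / s <= (g z - g (z - s *: row_mx v 0)) / s + e / 2.
  have /cvgrPdist_le/(_ _ e20) := ct; apply: filterS => w /=.
  by rewrite ler_norml => /andP[? ?]; lra.
have YOz : \forall w \near z, OY (rsubmx w) by exact: (rz _ zOY).
have Ow : \forall w \near z, Omega (lsubmx w - s *: v).
  have : (fun w => lsubmx w - s *: v) @ nbhs z --> lsubmx z - s *: v.
    by apply: cvgB; [exact: lz|exact: cvg_cst].
  by apply; rewrite -scalerN.
have Op : \forall p \near filter_prod (nbhs z) (0 : R)^'+,
    Omega (lsubmx p.1 + p.2 *: v).
  have h1 : (fun p => lsubmx p.1) @ filter_prod (nbhs z) (0 : R)^'+ --> lsubmx z.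
    exact: (cvg_comp _ _ (@cvg_fst _ _ (nbhs z) (0 : R)^'+ _) lz).
  have h2 : (fun p => p.2 *: v) @ filter_prod (nbhs z) (0 : R)^'+ --> (0 : 'rV[R]_n).
    rewrite -(scale0r v); apply: cvgZr_tmp.
    apply: cvg_trans (@cvg_snd _ _ (nbhs z) (0 : R)^'+ _) _.
    exact: cvg_within.
  have := cvgD h1 h2; rewrite addr0; exact.
near=> p.
have t0 : 0 < p.2.
  by near: p; exact: (near_snd _ _ (nbhs_right_gt 0)).
have ts : p.2 < s.
  by near: p; exact: (near_snd _ _ (nbhs_right_lt s0)).
have pY : OY (rsubmx p.1).
  by near: p; exact: (near_fst _ _ YOz).
have pOs : Omega (lsubmx p.1 - s *: v).
  by near: p; exact: (near_fst _ _ Ow).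
have pOt : Omega (lsubmx p.1 + p.2 *: v) by near: p.
have pg : (g p.1 - g (p.1 - s *: row_mx v 0)) / s <=
    (g z - g (z - s *: row_mx v 0)) / s + e / 2.
  by near: p; exact: (near_fst _ _ cte).
have := weakly_concave_slope (wc _ pY) s0 t0 pOs pOt.
rewrite -/(slice p.1 (lsubmx p.1 - s *: v)) slice_shift row_mx_shift hsubmxK.
move=> /le_trans; apply.
have : rho / 2 * (s + p.2) * dotp v v <= e / 2.
  rewrite ltr_pdivlMr// in se.
  have Q := dotp_ge0 v.
  have : rho / 2 * (s + p.2) * dotp v v <= s * (rho * dotp v v).
    rewrite (_ : s * _ = rho / 2 * (s + s) * dotp v v); last by field.
    by rewrite ler_wpM2r// ler_pM2l ?divr_gt0// lerD2l ltW.
  by move/le_trans; apply; rewrite (le_trans _ (ltW se))// ler_pM2l// ler_pM2l// lerDl.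
by move: pg; lra.
Unshelve. all: by end_near. Qed.

End partial_clarke.

(** * The value function of the original problem *)

Lemma argmin_minval (R : realType) (T : Type) (A : set T) (f : T -> R) y :
  argmin A f y -> minval A f = f y.
Proof.
move=> Afy; rewrite /minval.
have : (f @` argmin A f) !=set0 by exists (f y); exists y.
move=> /(xgetPex 0)[y' [Ay' y'_min] <-].
by apply/eqP; rewrite eq_le y'_min ?Afy.2//; case: Afy.
Qed.

Lemma optval_le (R : realType) (n m : nat) (Y : set 'rV[R]_m)
    (h : 'rV[R]_(n + m) -> R) x y :
  optsol Y h x !=set0 -> Y y -> optval Y h x <= h (row_mx x y).
Proof. by move=> [y' hy'] Yy; rewrite /optval (argmin_minval hy'); apply: hy'.2. Qed.

Lemma lipschitz_dist (R : realType) (d : nat) (g : 'rV[R]_d -> R) :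
  lipschitz g -> exists2 L, 0 < L & forall z z', `|g z - g z'| <= L * `|z - z'|.
Proof.
move=> /pinfty_ex_gt0[L L0 gL]; exists L => // z z'.
by apply: (gL (z, z')).
Qed.

Lemma lipschitz_continuous (R : realType) (d : nat) (g : 'rV[R]_d -> R) :
  lipschitz g -> continuous g.
Proof.
move=> /lipschitz_dist[L L0 gL] z; apply/(@cvgrPdist_lt _ _ _ (nbhs z)) => e e0.
have eL : 0 < e / L by rewrite divr_gt0.
by near=> z'; rewrite (le_lt_trans (gL _ _))// mulrC -ltr_pdivlMr.
Unshelve. all: by end_near. Qed.

Section parametric_minimization.
Variables (R : realType) (n m : nat) (OX : set 'rV[R]_n) (Y : set 'rV[R]_m).
Variable g : 'rV[R]_(n + m) -> R.
Hypotheses (OX_open : open OX) (Y_neq0 : Y !=set0) (Y_closed : closed Y).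
Hypotheses (g_lip : lipschitz g) (g_level_bounded : level_bounded g).

Let continuous_slice (h : 'rV[R]_(n + m) -> R) x :
  continuous h -> continuous (fun y => h (row_mx x y)).
Proof.
move=> ch y; have xy : (fun y' => row_mx x y') @ nbhs y --> row_mx x y.
  by apply: (@cvg_row_mx _ _ _ _ (nbhs y) _ (cst x) id); [exact: cvg_cst|exact: cvg_id].
exact: (continuous_cvg _ (ch _) xy).
Qed.

Lemma optsol_neq0 x : optsol Y g x !=set0.
Proof.
have [y0 Yy0] := Y_neq0.
have [r r0 [M [_ gM]]] := g_level_bounded x (g (row_mx x y0)).
apply: (@argmin_nonempty _ _ _ (fun y => g (row_mx x y)) _ (M + 1) Y_closed _ Yy0).
  exact: continuous_slice (lipschitz_continuous g_lip).
move=> y _ gy; rewrite -[y](row_mxKr x) (le_trans (norm_rsubmx _))//.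
apply: (gM (M + 1)); first by rewrite ltrDl.
by split; rewrite ?row_mxKl//; exact: ballxx.
Qed.

Lemma optval_continuous : continuous (optval Y g).
Proof.
have [L L0 gL] := lipschitz_dist g_lip.
(* Testing the problem at [x] with a minimiser for [x'] shows that the value function inherits the
   Lipschitz constant of [g]. *)
have le_v x x' : optval Y g x <= optval Y g x' + L * `|x - x'|.
  have [y' gy'] := optsol_neq0 x'.
  rewrite {2}/optval (argmin_minval gy').
  rewrite (le_trans (optval_le (optsol_neq0 x) gy'.1))// -lerBlDl.
  rewrite (le_trans (ler_norm _))// (le_trans (gL _ _))// ler_pM2l//.
  by rewrite opp_row_mx add_row_mx subrr norm_row_mx normr0 (max_idPl _).
move=> x; apply/(@cvgrPdist_lt _ _ _ (nbhs x)) => e e0.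
have eL : 0 < e / L by rewrite divr_gt0.
near=> x'; have xx' : L * `|x - x'| < e.
  by rewrite mulrC -ltr_pdivlMr.
have := le_v x x'; have := le_v x' x; rewrite (distrC x').
by rewrite ltr_norml => ? ?; apply/andP; split; lra.
Unshelve. all: by end_near. Qed.

(** * The regularised problem: unique, continuous minimisers *)

Variable g_ : R -> 'rV[R]_(n + m) -> R.
Hypotheses (Y_convex : convex_set Y)
  (g_C1 : forall mu, 0 < mu -> C1_on setT (g_ mu))
  (g_bounded_below : forall Omega' : set 'rV[R]_n,
    open Omega' -> closure Omega' `<=` OX -> forall mu : R, 0 < mu ->
    has_lbound (g_ mu @` pairs (closure Omega') Y))
  (g_convex_mu : forall x (mu : R), OX x -> 0 < mu ->
    convex_function setT (fun y => g_ mu (row_mx x y)))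
  (g_uniform : forall Omega' : set 'rV[R]_n,
    open Omega' -> closure Omega' `<=` OX ->
    {uniform pairs (closure Omega') Y, g_ @ (0 : R)^'+ --> g}).

Lemma continuous_quad_reg mu : 0 < mu -> continuous (quad_reg g_ mu).
Proof.
move=> mu0 z; have [/differentiable_continuous cg _] := g_C1 mu0 (I : setT z).
have cr := @continuous_rsubmx R 1 n m z.
have cd : (fun w : 'rV[R]_(n + m) => dotp (rsubmx w) (rsubmx w)) @ nbhs z -->
    dotp (rsubmx z) (rsubmx z) by exact: (@cvg_dotp _ _ _ _ _ _ _ _ _ cr cr).
exact: (cvgD cg (cvgM (@cvg_cst _ (mu / 2) _ (nbhs z) _) cd)).
Qed.

Lemma closed_ball_sub_OX x : OX x -> exists2 r : R, 0 < r & closure (ball x r) `<=` OX.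
Proof.
move=> OXx; have /nbhs_closedballP[r rOX] := open_nbhs_nbhs (conj OX_open OXx).
by exists r%:num.
Qed.

(** A lower bound [c] of [g_ mu] over a ball around [x] leaves at most [K - c] for the quadratic
    term, so sublevel sets are bounded uniformly in [x']. *)
Lemma optsol_quad_reg_bounded x mu K : OX x -> 0 < mu ->
  exists r M : R, 0 < r /\
    forall x' y, `|x - x'| < r -> Y y -> quad_reg g_ mu (row_mx x' y) <= K -> `|y| <= M.
Proof.
move=> OXx mu0; have [r r0 rOX] := closed_ball_sub_OX OXx.
have [c cg] := g_bounded_below (ball_open x r) rOX mu0.
exists r, (2 * (K - c) / mu + 1); split=> // x' y xx' Yy.
rewrite /quad_reg row_mxKr => yK.
have cy : c <= g_ mu (row_mx x' y).
  apply: cg; exists (row_mx x' y) => //; split; rewrite ?row_mxKr// row_mxKl.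
  by apply: subset_closure; rewrite -ball_normE.
have := sqr_norm_le_dotp y => y2.
have : mu * `|y| ^+ 2 <= 2 * (K - c) by nra.
rewrite mulrC -ler_pdivlMr// => h.
have : 0 <= (`|y| - 1) ^+ 2 by exact: sqr_ge0.
by have := normr_ge0 y; nra.
Qed.

Lemma optsol_quad_reg_neq0 x mu : OX x -> 0 < mu -> optsol Y (quad_reg g_ mu) x !=set0.
Proof.
move=> OXx mu0; have [y0 Yy0] := Y_neq0.
have [r [M [r0 rM]]] := optsol_quad_reg_bounded (quad_reg g_ mu (row_mx x y0)) OXx mu0.
apply: (@argmin_nonempty _ _ _ (fun y => quad_reg g_ mu (row_mx x y)) _ M Y_closed _ Yy0).
  exact: continuous_slice (continuous_quad_reg mu0).
by move=> y Yy; apply: (rM x) => //; rewrite subrr normr0.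
Qed.

(** Strong convexity: at the midpoint of two minimisers the objective would drop by at least
    [mu / 8] times the squared Euclidean distance between them. *)
Lemma optsol_quad_reg_inj x mu y y' : OX x -> 0 < mu ->
  optsol Y (quad_reg g_ mu) x y -> optsol Y (quad_reg g_ mu) x y' -> y = y'.
Proof.
move=> OXx mu0 [Yy ymin] [Yy' y'min].
have half : 0 <= (2^-1 : R) <= 1 by apply/andP; split; lra.
pose yh := 2^-1 *: y + (1 - 2^-1) *: y'.
have Yh : Y yh.
  have /andP[h0 h1] := half.
  by have := Y_convex (Itv01 h0 h1) (mem_set Yy) (mem_set Yy'); rewrite inE.
have := convex_functionP (g_convex_mu OXx mu0) (I : setT y) (I : setT y') half.
have := ymin _ Yh; have := y'min _ Yy; have := ymin _ Yy'.
rewrite /quad_reg !row_mxKr -/yh => h1 h2 h3 h4.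
apply/eqP; rewrite -subr_eq0 -dotp_eq0 eq_le dotp_ge0 andbT.
have -> : dotp (y - y') (y - y') = dotp y y - 2 * dotp y y' + dotp y' y'.
  by rewrite dotpBl !dotpBr (dotpC y' y); ring.
have hE : dotp yh yh = 4^-1 * dotp y y + 2^-1 * dotp y y' + 4^-1 * dotp y' y'.
  by rewrite /yh dotpDl !dotpDr !dotpZl !dotpZr (dotpC y' y); field.
rewrite hE in h3.
have : mu * (dotp y y - 2 * dotp y y' + dotp y' y') <= 0.
  move: h1 h2 h3 h4; set a := g_ mu _; set b := g_ mu _; set c := g_ mu _.
  by lra.
by rewrite pmulr_rle0.
Qed.

Definition ysol mu x := xget 0 (optsol Y (quad_reg g_ mu) x).

Lemma ysolP mu x : OX x -> 0 < mu -> optsol Y (quad_reg g_ mu) x (ysol mu x).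
Proof. by move=> OXx mu0; exact: (xgetPex 0 (optsol_quad_reg_neq0 OXx mu0)). Qed.

Lemma vquadE mu x : OX x -> 0 < mu ->
  optval Y (quad_reg g_ mu) x = quad_reg g_ mu (row_mx x (ysol mu x)).
Proof. by move=> OXx mu0; exact: argmin_minval (ysolP OXx mu0). Qed.

Lemma near_OX x : OX x -> \forall x' \near x, OX x'.
Proof. by move=> OXx; exact: open_nbhs_nbhs (conj OX_open OXx). Qed.

(** Minimisers along a sequence tending to [x] are bounded, a limit of a subsequence is again a
    minimiser, and uniqueness identifies it with [ysol mu x]. *)
Lemma ysol_continuous mu x : OX x -> 0 < mu -> {for x, continuous (ysol mu)}.
Proof.
move=> OXx mu0; apply: subsequence_continuous => u ux.
have [y0 Yy0] := Y_neq0; set h := quad_reg g_ mu.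
have ch : continuous h by exact: continuous_quad_reg.
have hu y (f : nat -> nat) : (forall k, (k <= f k)%N) ->
    (fun k => h (row_mx (u (f k)) y)) @ \oo --> h (row_mx x y).
  move=> kf; apply: (continuous_cvg _ (ch _)); apply: cvg_row_mx.
    exact: cvg_comp (cvg_ge_id kf) ux.
  exact: cvg_cst.
(* The minimal value at [u k] is at most [h (row_mx (u k) y0)], eventually below this level. *)
have [r [M [r0 rM]]] := optsol_quad_reg_bounded (h (row_mx x y0) + 1) OXx mu0.
have [f [p [kf fp]]] : exists f (p : 'rV[R]_m), (forall k, (k <= f k)%N) /\
    (ysol mu \o u) \o f @ \oo --> p.
  apply: (@bounded_subsequence _ _ _ M).
  have /cvgrPdist_lt/(_ _ ltr01) := hu y0 id leqnn.
  move=> h1; near=> k.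
  have OXk : OX (u k) by near: k; exact: (ux _ (near_OX OXx)).
  have [Yy /(_ _ Yy0) ymin] := ysolP OXk mu0.
  apply: (rM (u k)) => //; first by near: k; exact: (@cvgr_dist_lt _ _ _ _ _ u x ux r r0).
  apply: le_trans ymin _; rewrite addrC -lerBlDr; apply: ltW.
  apply: le_lt_trans (ler_norm _) _; rewrite distrC.
  by near: k.
exists f => //; suff -> : ysol mu x = p by [].
have OXf : \forall k \near \oo, OX (u (f k)).
  exact: (cvg_comp _ _ (cvg_ge_id kf) ux _ (near_OX OXx)).
apply: (optsol_quad_reg_inj OXx mu0 (ysolP OXx mu0)); split.
  apply: (closed_cvg _ Y_closed _ _ fp).
  by apply: filterS OXf => k OXk; case: (ysolP OXk mu0).
move=> y Yy; apply: (@ler_cvg_to _ \oo _ _ _ _ _ _ _ (hu y f kf)).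
  apply: (continuous_cvg _ (ch (row_mx x p))); apply: cvg_row_mx fp.
  exact: cvg_comp (cvg_ge_id kf) ux.
by apply: filterS OXf => k OXk; apply: (ysolP OXk mu0).2.
Unshelve. all: by end_near. Qed.

(** The quadratic term depends on [y] only and cancels in increments in [x], so Danskin's argument
    applies to [g_ mu] itself. *)
Lemma vquad_gradient mu x : OX x -> 0 < mu ->
  differentiable (optval Y (quad_reg g_ mu)) x /\
  gradient (optval Y (quad_reg g_ mu)) x =
    lsubmx (gradient (g_ mu) (row_mx x (ysol mu x))).
Proof.
move=> OXx mu0; have C1 z := g_C1 mu0 (I : setT z).
apply: danskin; [by move=> z; case: (C1 z)|by case: (C1 (row_mx x (ysol mu x)))| |].
  exact: ysol_continuous.
near=> x'; have OXx' : OX x' by near: x'; exact: near_OX.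
have := optval_le (optsol_quad_reg_neq0 OXx mu0) (ysolP OXx' mu0).1.
have := optval_le (optsol_quad_reg_neq0 OXx' mu0) (ysolP OXx mu0).1.
rewrite !vquadE// /quad_reg !row_mxKr.
set a := g_ _ _; set b := g_ _ _; set c := g_ _ _; set d := g_ _ _.
by move: (_ * dotp _ _) (_ * dotp _ _) => k k' ? ?; split; lra.
Unshelve. all: by end_near. Qed.

Lemma vquad_C1 mu : 0 < mu -> C1_on OX (optval Y (quad_reg g_ mu)).
Proof.
move=> mu0 x OXx; have [dv gv] := vquad_gradient OXx mu0; split=> //.
rewrite /prop_for/= /continuous_at gv.
have : (fun x' => lsubmx (gradient (g_ mu) (row_mx x' (ysol mu x')))) @ nbhs x -->
    lsubmx (gradient (g_ mu) (row_mx x (ysol mu x))).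
  apply: cvg_lsubmx.
  have [_ cg] := g_C1 mu0 (I : setT (row_mx x (ysol mu x))).
  apply: (continuous_cvg _ cg); apply: cvg_row_mx; first exact: cvg_id.
  exact: ysol_continuous.
move=> cgx; apply: cvg_trans cgx; apply: (@near_eq_cvg _ _ (nbhs x)); near=> x'.
have OXx' : OX x' by near: x'; exact: near_OX.
exact: esym (vquad_gradient OXx' mu0).2.
Unshelve. all: by end_near. Qed.


(** * Convergence of the regularised values *)

Lemma near_uniform x e : OX x -> 0 < e ->
  filter_prod (nbhs x) (0 : R)^'+
    [set p | forall y, Y y -> `|g (row_mx p.1 y) - g_ p.2 (row_mx p.1 y)| < e].
Proof.
move=> OXx e0; have [r r0 rOX] := closed_ball_sub_OX OXx.
have U := g_uniform (ball_open x r) rOX.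
have gU : \forall mu \near (0 : R)^'+, forall z, pairs (closure (ball x r)) Y z ->
    `|g z - g_ mu z| < e.
  apply: (U [set h | forall z, pairs (closure (ball x r)) Y z -> `|g z - h z| < e]).
  apply/uniform_nbhs.
  exists [set xy | ball xy.1 e xy.2]; split; first exact: (entourage_ball _ (PosNum e0)).
  by move=> h hE z Az; have := hE z Az; rewrite /= -ball_normE.
apply: (filterS _
  (filterI (near_fst _ _ (nbhsx_ballx x r r0)) (near_snd _ _ gU))) => p /= [xp gp] y Yy.
by apply: gp; split; rewrite ?row_mxKr// row_mxKl; exact: subset_closure.
Qed.

Let near_OX_gt0 x : OX x -> 
  filter_prod (nbhs x) (0 : R)^'+ [set p | OX p.1 /\ 0 < p.2].
Proof.
move=> OXx.
exact: filterI (near_fst _ _ (near_OX OXx)) (near_snd _ _ (nbhs_right_gt 0)).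
Qed.

Lemma near_ysol_le_vquad x e : OX x -> 0 < e ->
  filter_prod (nbhs x) (0 : R)^'+
    [set p | g (row_mx p.1 (ysol p.2 p.1)) - e <= optval Y (quad_reg g_ p.2) p.1].
Proof.
move=> OXx e0.
apply: (filterS _ (filterI (near_OX_gt0 OXx) (near_uniform OXx e0))) => p /=.
move=> [[OXp p0] Up].
have [Ys _] := ysolP OXp p0.
move: (Up _ Ys); rewrite vquadE// /quad_reg row_mxKr ltr_norml => /andP[_ h1].
have : 0 <= p.2 / 2 * dotp (ysol p.2 p.1) (ysol p.2 p.1).
  by rewrite mulr_ge0 ?dotp_ge0// divr_ge0// ltW.
by lra.
Qed.

(** From above, a fixed minimiser [y0] at [x] is tested, with thirds of [e] for continuity of [g],
    uniform convergence and the quadratic term. From below, the regulariser is dropped and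
    continuity of the value function is used, with halves of [e]. *)
Lemma vquad_cvg x : OX x ->
  (fun p : 'rV[R]_n * R => optval Y (quad_reg g_ p.2) p.1) @
    filter_prod (nbhs x) (0 : R)^'+ --> optval Y g x.
Proof.
move=> OXx; apply/cvgrPdist_le => e e0.
have [y0 y0min] := optsol_neq0 x; have [Yy0 _] := y0min.
have e30 : 0 < e / 3 by rewrite divr_gt0.
have e20 : 0 < e / 2 by rewrite divr_gt0.
have D0 : 0 < dotp y0 y0 + 1 by rewrite ltr_wpDl// dotp_ge0.
have eD0 : 0 < e / 3 / (dotp y0 y0 + 1) by rewrite divr_gt0.
have cy0 : (fun x' => g (row_mx x' y0)) @ nbhs x --> g (row_mx x y0).
  have xy : (fun x' => row_mx x' y0) @ nbhs x --> row_mx x y0.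
    apply: (@cvg_row_mx _ _ _ _ (nbhs x) _ id (cst y0)); first exact: cvg_id.
    exact: cvg_cst.
  exact: (continuous_cvg _ (@lipschitz_continuous _ _ _ g_lip _) xy).
have N1 : \forall x' \near x, `|g (row_mx x y0) - g (row_mx x' y0)| < e / 3 by
  exact: (@cvgr_dist_lt _ _ _ _ _ _ _ cy0).
have N2 : \forall x' \near x, `|optval Y g x - optval Y g x'| < e / 2 by
  exact: (@cvgr_dist_lt _ _ _ _ _ _ _ (@optval_continuous x)).
apply: (filterS _ (filterI
  (filterI (near_OX_gt0 OXx) (near_snd _ _ (nbhs_right_lt eD0)))
  (filterI (filterI (near_fst _ _ N1) (near_fst _ _ N2))
    (filterI (near_ysol_le_vquad OXx e20) (near_uniform OXx e30))))) => p /=.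
move=> [[[OXp p0] pD] [[H1 H2] [H3 H4]]].
have := optval_le (optsol_neq0 p.1) (ysolP OXp p0).1.
have := optval_le (optsol_quad_reg_neq0 OXp p0) Yy0.
have := H4 _ Yy0; have : p.2 / 2 * dotp y0 y0 <= e / 3.
  move: pD; rewrite ltr_pdivlMr// mulrDr mulr1 => pD.
  by have := mulr_ge0 (ltW p0) (dotp_ge0 y0); lra.
rewrite {2}/quad_reg row_mxKr.
have vx : optval Y g x = g (row_mx x y0) by exact: argmin_minval y0min.
move: H1 H2 H3; rewrite -vx.
set q := optval Y (quad_reg _ _) _; set v := optval Y g x; set v' := optval Y g _.
set a := g (row_mx p.1 y0); set b := g (row_mx p.1 _); set c := g_ _ _.
set d := _ / 2 * dotp y0 y0.
rewrite !ltr_norml ler_norml => /andP[? ?] /andP[? ?] ? ? /andP[? ?] ? ?.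
by apply/andP; split; lra.
Qed.

(** * First-order optimality and limits of gradients *)

Lemma first_order_optimality x mu y y' : 0 < mu ->
  optsol Y (quad_reg g_ mu) x y -> Y y' ->
  0 <= dotp (rsubmx (gradient (g_ mu) (row_mx x y))) (y' - y) + mu * dotp y (y' - y).
Proof.
move=> mu0 [Yy ymin] Yy'; set w := y' - y; set z := row_mx x y.
have [dg _] := g_C1 mu0 (I : setT z).
have /cvg_dnbhs_at_right : (fun t : R =>
      t^-1 *: ((g_ mu \o shift z) (t *: row_mx 0 w) - g_ mu z)) @ (0 : R)^' -->
    dotp (rsubmx (gradient (g_ mu) z)) w.
  rewrite -dotp_row_mxr -diff_gradient// -deriveE//.
  exact: (diff_derivable dg).
move=> cq.
(* Minus the quotient of the quadratic term along [y + t *: w]. By minimality it is at most the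
   quotient of [g_ mu], and both sides converge. *)
have cl : (fun t : R => - (mu / 2) * (2 * dotp y w + t * dotp w w)) @ (0 : R)^'+ -->
    - (mu / 2) * (2 * dotp y w + 0 * dotp w w).
  apply: cvg_at_right_filter; apply: cvgM; first exact: cvg_cst.
  apply: cvgD; first exact: cvg_cst.
  by apply: cvgM; [exact: cvg_id|exact: cvg_cst].
suff : - (mu / 2) * (2 * dotp y w + 0 * dotp w w) <=
    dotp (rsubmx (gradient (g_ mu) z)) w by lra.
apply: (@ler_cvg_to _ (0 : R)^'+ _ _ _ _ _ _ cl cq).
near=> t.
have t0 : 0 < t by [].
have t1 : t <= 1 by near: t; exact: nbhs_right_le.
have Yt : Y (y + t *: w).
  have := Y_convex (Itv01 (ltW t0) t1) (mem_set Yy') (mem_set Yy).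
  rewrite inE; congr Y.
  rewrite /w scalerBr addrC -addrA; congr (_ + _).
  by rewrite addrC -[X in X - _]scale1r -scalerBl.
have := ymin _ Yt; rewrite /quad_reg !row_mxKr.
have -> : row_mx x (y + t *: w) = t *: row_mx 0 w + z.
  by rewrite scale_row_mx scaler0 add_row_mx add0r addrC.
rewrite dotpDD dotpZl !dotpZr => h.
rewrite /= [_ *: _]mulrC ler_pdivlMr//.
by lra.
Unshelve. all: by end_near. Qed.


Lemma cvg_filter_prod_right (x : 'rV[R]_n) (xs : nat -> 'rV[R]_n) (mus : nat -> R) :
  xs @ \oo --> x -> (forall k, 0 < mus k) -> mus @ \oo --> (0 : R) ->
  (fun k => (xs k, mus k)) @ \oo --> filter_prod (nbhs x) (0 : R)^'+.
Proof.
move=> xsx mus0 musc.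
have mus_right : mus @ \oo --> (0 : R)^'+.
  move=> A A0; have : \forall k \near \oo, 0 < mus k -> A (mus k) by exact: (musc _ A0).
  by apply: filterS => k; exact.
exact: (@cvg_pair _ _ _ \oo (nbhs x) (0 : R)^'+ _ _ _ _ _ xsx mus_right).
Qed.

(** Up to a vanishing error, [g] at the regularised minimisers is at most the regularised value,
    which tends to the value at [x]. This bounds the minimisers by level-boundedness and makes their
    limit points optimal. *)
Lemma ysol_subsequence x (xs : nat -> 'rV[R]_n) (mus : nat -> R) : OX x ->
  xs @ \oo --> x -> (forall k, 0 < mus k) -> mus @ \oo --> (0 : R) ->
  exists f y, [/\ forall k, (k <= f k)%N,
    (fun k => ysol (mus (f k)) (xs (f k))) @ \oo --> y & optsol Y g x y].
Proof.
move=> OXx xsx mus0 musc; have cp := cvg_filter_prod_right xsx mus0 musc.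
have cg : continuous g := lipschitz_continuous g_lip.
pose yk k := ysol (mus k) (xs k); pose vk k := optval Y (quad_reg g_ (mus k)) (xs k).
have cv : vk @ \oo --> optval Y g x by exact: (cvg_comp _ _ cp (vquad_cvg OXx)).
have OXk : \forall k \near \oo, OX (xs k) by exact: (xsx _ (near_OX OXx)).
have gyk e : 0 < e -> \forall k \near \oo, g (row_mx (xs k) (yk k)) - e <= vk k.
  by move=> e0; exact: (cp _ (near_ysol_le_vquad OXx e0)).
(* One unit covers the gap between [g] and the regularised value, the other the convergence of the
   latter. *)
have [r r0 [M [_ gM]]] := g_level_bounded x (optval Y g x + 2).
have ykM : \forall k \near \oo, `|yk k| <= M + 1.
  have vk1 : \forall k \near \oo, `|optval Y g x - vk k| < 1.
    exact: (@cvgr_dist_lt _ _ _ _ _ _ _ cv).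
  have gy1 := gyk 1 ltr01.
  near=> k; rewrite -[yk k](row_mxKr (xs k)) (le_trans (norm_rsubmx _))//.
  apply: (gM (M + 1)); first by rewrite ltrDl.
  split; rewrite ?row_mxKl/=; first by near: k; exact: (xsx _ (nbhsx_ballx x r r0)).
  have : `|optval Y g x - vk k| < 1 by near: k.
  have : g (row_mx (xs k) (yk k)) - 1 <= vk k by near: k.
  by rewrite ltr_norml => ? /andP[? ?]; lra.
have [f [y [kf fy]]] := bounded_subsequence ykM.
have foo := cvg_ge_id kf.
exists f, y; split=> //; split.
  apply: (closed_cvg _ Y_closed _ _ fy).
  have : \forall k \near \oo, OX (xs (f k)) by exact: (foo _ OXk).
  by apply: filterS => k OXfk; case: (ysolP OXfk (mus0 (f k))).
suff gxy : g (row_mx x y) <= optval Y g x.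
  by move=> y' Yy'; rewrite (le_trans gxy)// optval_le//; exact: optsol_neq0.
apply/ler_addgt0Pr => e e0; rewrite -lerBlDr.
have cgf : (fun k => g (row_mx (xs (f k)) (yk (f k))) - e) @ \oo --> g (row_mx x y) - e.
  apply: cvgB; last exact: cvg_cst.
  have xyf : (fun k => row_mx (xs (f k)) (yk (f k))) @ \oo --> row_mx x y.
    by apply: cvg_row_mx fy; exact: (cvg_comp _ _ foo xsx).
  exact: (continuous_cvg _ (cg _) xyf).
have cvf : (vk \o f) @ \oo --> optval Y g x by exact: (cvg_comp _ _ foo cv).
apply: (@ler_cvg_to _ \oo _ _ _ _ _ _ cgf cvf).
exact: (foo _ (gyk e e0)).
Unshelve. all: by end_near. Qed.

(** Two successive extractions: first the minimisers converge to a solution [y], then local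
    boundedness near [y] makes the full gradients converge. In the optimality inequality the term
    with factor [mu] vanishes in the limit. *)
Lemma gradient_vquad_subsequence x (xs : nat -> 'rV[R]_n) (mus : nat -> R) : OX x ->
  (forall y, optsol Y g x y -> exists2 Theta : set ('rV[R]_(n + m) * R),
      nbhs (row_mx x y, 0 : R) Theta &
      bounded_set [set gradient (g_ p.2) p.1 | p in Theta `&` [set p | 0 < p.2]]) ->
  xs @ \oo --> x -> (forall k, 0 < mus k) -> mus @ \oo --> (0 : R) ->
  exists f y zeta, [/\ forall k, (k <= f k)%N,
    (fun k => gradient (optval Y (quad_reg g_ (mus (f k)))) (xs (f k))) @ \oo -->
      lsubmx zeta,
    optsol Y g x y,
    limsup_gradient g_ (row_mx x y) zeta &
    forall y', Y y' -> 0 <= dotp (rsubmx zeta) (y' - y)].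
Proof.
move=> OXx g_bd xsx mus0 musc.
have [f1 [y [kf1 yk1 gxy]]] := ysol_subsequence OXx xsx mus0 musc.
have [V Vxy [M [_ VM]]] := g_bd _ gxy.
pose zk k := row_mx (xs k) (ysol (mus k) (xs k)).
have zf1 : (zk \o f1) @ \oo --> row_mx x y.
  by apply: cvg_row_mx yk1; exact: (cvg_comp _ _ (cvg_ge_id kf1) xsx).
have mf1 : (mus \o f1) @ \oo --> (0 : R) by exact: (cvg_comp _ _ (cvg_ge_id kf1) musc).
pose Gk k := gradient (g_ (mus k)) (zk k).
have GM : \forall k \near \oo, `|(Gk \o f1) k| <= M + 1.
  have pT : (fun k => ((zk \o f1) k, (mus \o f1) k)) @ \oo --> (row_mx x y, 0 : R).
    exact: (@cvg_pair _ _ _ \oo (nbhs (row_mx x y)) (nbhs (0 : R)) _ _ _ _ _ zf1 mf1).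
  have : \forall k \near \oo, V (zk (f1 k), mus (f1 k)) by exact: (pT _ Vxy).
  apply: filterS => k Vk; apply: (VM (M + 1)); first by rewrite ltrDl.
  by exists (zk (f1 k), mus (f1 k)) => //; split=> //=; exact: mus0.
have [f2 [zeta [kf2 Gf2]]] := bounded_subsequence GM.
pose f := f1 \o f2.
have kf k : (k <= f k)%N by exact: leq_trans (kf2 k) (kf1 _).
have zf : (zk \o f) @ \oo --> row_mx x y by exact: (cvg_comp _ _ (cvg_ge_id kf2) zf1).
have mf : (mus \o f) @ \oo --> (0 : R) by exact: (cvg_comp _ _ (cvg_ge_id kf2) mf1).
have yf : (fun k => ysol (mus (f k)) (xs (f k))) @ \oo --> y.
  exact: (cvg_comp _ _ (cvg_ge_id kf2) yk1).
have Gf : (Gk \o f) @ \oo --> zeta by exact: Gf2.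
have OXf : \forall k \near \oo, OX (xs (f k)).
  by exact: (cvg_comp _ _ (cvg_ge_id kf) xsx _ (near_OX OXx)).
exists f, y, zeta; split=> //.
- have cl : (fun k => lsubmx (Gk (f k))) @ \oo --> lsubmx zeta by exact: cvg_lsubmx Gf.
  apply: cvg_trans cl; apply: (@near_eq_cvg _ _ \oo); near=> k.
  have OXk : OX (xs (f k)) by near: k.
  exact: esym (vquad_gradient OXk (mus0 (f k))).2.
- by exists (zk \o f), (mus \o f); split=> // k; exact: mus0.
move=> y' Yy'.
have yy' : (fun k => y' - ysol (mus (f k)) (xs (f k))) @ \oo --> y' - y.
  by apply: cvgB yf; exact: cvg_cst.
have cl : (fun k => dotp (rsubmx (Gk (f k))) (y' - ysol (mus (f k)) (xs (f k))) +
    mus (f k) * dotp (ysol (mus (f k)) (xs (f k))) (y' - ysol (mus (f k)) (xs (f k))))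
    @ \oo --> dotp (rsubmx zeta) (y' - y) + 0 * dotp y (y' - y).
  apply: cvgD.
    have cr : (fun k => rsubmx (Gk (f k))) @ \oo --> rsubmx zeta by exact: cvg_rsubmx Gf.
    exact: cvg_dotp cr yy'.
  by apply: cvgM mf _; exact: cvg_dotp yf yy'.
rewrite -[leRHS]addr0 -[X in _ + X](mul0r (dotp y (y' - y))).
apply: (@ler_cvg_to _ \oo _ _ _ _ _ _ (@cvg_cst _ (0 : R) _ \oo _) cl).
apply: filterS OXf => k OXk.
exact: (first_order_optimality (mus0 (f k)) (ysolP OXk (mus0 (f k))) Yy').
Unshelve. all: by end_near. Qed.

End parametric_minimization.

(** * From subgradients of [g] to subgradients of the value function *)

Section optval_subdifferential.
Variables (R : realType) (n m : nat) (Y : set 'rV[R]_m).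
Variables (g : 'rV[R]_(n + m) -> R) (x : 'rV[R]_n) (y : 'rV[R]_m).
Variable zeta : 'rV[R]_(n + m).
Hypotheses (sol_neq0 : forall x', optsol Y g x' !=set0) (sol_y : optsol Y g x y).
Hypothesis zetaP : clarke_subdiff g (row_mx x y) zeta.

(** The slice of [g] at the solution [y] majorises the value function and touches it at [x]. *)
Lemma optval_subdiff_backward :
  (forall v e, 0 < e -> \forall t \near (0 : R)^'+, dotp (lsubmx zeta) v - e <=
    (g (row_mx x y) - g (row_mx (x - t *: v) y)) / t) ->
  clarke_subdiff (optval Y g) x (lsubmx zeta).
Proof.
apply: (@clarke_subdiff_touching_above _ _ _ (fun x' => g (row_mx x' y))).
  by apply: (@nearW _ (nbhs x)) => x'; apply: optval_le => //; case: sol_y.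
exact: argmin_minval.
Qed.

Lemma optval_subdiff_gradient_x (Omega : set 'rV[R]_n) : Omega x ->
  gradient_x_continuous_on g (pairs Omega Y) ->
  clarke_subdiff (optval Y g) x (lsubmx zeta).
Proof.
move=> Ox dg; apply: optval_subdiff_backward => v e e0.
have [|dgz cgz] := dg (row_mx x y).
  by split; rewrite ?row_mxKl ?row_mxKr//; case: sol_y.
by have := clarke_gradient_x v dgz cgz zetaP e0; rewrite row_mxKl row_mxKr.
Qed.

Lemma optval_subdiff_weakly_concave (Omega : set 'rV[R]_n) (OY : set 'rV[R]_m) rho :
  nbhs x Omega -> nbhs y OY -> continuous g -> 0 < rho ->
  (forall y', OY y' -> weakly_concave rho Omega (fun x' => g (row_mx x' y'))) ->
  clarke_subdiff (optval Y g) x (lsubmx zeta).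
Proof.
move=> xO yO cg rho0 wc; apply: optval_subdiff_backward => v e e0.
have := @clarke_weakly_concave _ _ _ g Omega OY rho (row_mx x y) zeta v.
by rewrite row_mxKl row_mxKr; exact.
Qed.

(** The subgradient inequality for [g] is taken at ([x'], [y']) with [y'] a solution at [x']; the
    optimality condition makes its [y]-part nonnegative, which leaves a subgradient inequality for
    the value function. *)
Lemma optval_subdiff_convex : convex_function setT g -> continuous g ->
  (forall y', Y y' -> 0 <= dotp (rsubmx zeta) (y' - y)) ->
  clarke_subdiff (optval Y g) x (lsubmx zeta).
Proof.
move=> cvxg cg etaP; apply: clarke_subdiff_convex; apply: (@nearW _ (nbhs x)) => x'.
have [y' sol_y'] := sol_neq0 x'.
rewrite /optval (argmin_minval sol_y) (argmin_minval sol_y').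
apply: le_trans (clarke_subdiff_convex_ge (row_mx x' y') cvxg cg zetaP).
rewrite opp_row_mx add_row_mx -{2}[zeta]hsubmxK dotp_row_mx lerD2l lerDl.
by apply: etaP; case: sol_y'.
Qed.

End optval_subdifferential.

Theorem theorem3p14 (R : realType) (n m : nat)
  (X OX : set 'rV[R]_n) (Y OY : set 'rV[R]_m)
  (X_neq0 : X !=set0) (X_closed : closed X) (X_convex : convex_set X)
  (Y_neq0 : Y !=set0) (Y_closed : closed Y) (Y_convex : convex_set Y)
  (OX_open : open OX) (X_OX : X `<=` OX)
  (OY_open : open OY) (Y_OY : Y `<=` OY)
  (g : 'rV[R]_(n + m) -> R)
  (g_lip : lipschitz g)
  (g_convex : forall x, OX x -> convex_function setT (fun y => g (row_mx x y)))
  (g_ : R -> 'rV[R]_(n + m) -> R)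
  (g_smooth : smooth_approximations setT g g_)
  (g_consistent : forall z, gradient_consistent_at g g_ z)
  (g_bounded_below : forall Omega' : set 'rV[R]_n,
    open Omega' -> closure Omega' `<=` OX -> forall mu : R, 0 < mu ->
    has_lbound (g_ mu @` pairs (closure Omega') Y))
  (g_convex_mu : forall x (mu : R), OX x -> 0 < mu ->
    convex_function setT (fun y => g_ mu (row_mx x y)))
  (g_continuous_mu : forall (z : 'rV[R]_(n + m)) (mu : R), 0 < mu ->
    {for (z, mu), continuous (fun p : 'rV[R]_(n + m) * R => g_ p.2 p.1)})
  (g_level_bounded : level_bounded g)
  (g_uniform : forall Omega' : set 'rV[R]_n,
    open Omega' -> closure Omega' `<=` OX ->
    {uniform pairs (closure Omega') Y, g_ @ (0 : R)^'+ --> g})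
  (xbar : 'rV[R]_n) (OX_xbar : OX xbar)
  (gradient_bounded : forall ybar, optsol Y g xbar ybar ->
    exists2 Theta : set ('rV[R]_(n + m) * R),
      nbhs (row_mx xbar ybar, 0 : R) Theta &
      bounded_set [set gradient (g_ p.2) p.1 | p in Theta `&` [set p | 0 < p.2]])
  (Omega : set 'rV[R]_n) (Omega_xbar : nbhs xbar Omega)
  (cond_abc :
    [\/ gradient_x_continuous_on g (pairs Omega Y),
        convex_set Omega /\
        (exists2 rho : R, 0 < rho &
           forall y, OY y -> weakly_concave rho Omega (fun x => g (row_mx x y))) |
        (forall ybar, optsol Y g xbar ybar ->
           clarke_subdiff g (row_mx xbar ybar) =
           pairs (clarke_subdiff (fun x => g (row_mx x ybar)) xbar)
                 (clarke_subdiff (fun y => g (row_mx xbar y)) ybar)) /\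
        convex_function setT g]) :
  let v := optval Y g in
  let vquad := fun mu : R => optval Y (quad_reg g_ mu) in
  [/\ (* the minima defining v and vquad are attained *)
      (forall x, OX x -> optsol Y g x !=set0),
      (forall x (mu : R), OX x -> 0 < mu -> optsol Y (quad_reg g_ mu) x !=set0),
      smooth_approximations OX v vquad &
      gradient_consistent_at v vquad xbar].
Proof.
move=> v vquad.
have g_C1 mu : 0 < mu -> C1_on setT (g_ mu) by case: g_smooth => _ _ + _; exact.
have cg := lipschitz_continuous g_lip.
have sol_neq0 := optsol_neq0 Y_neq0 Y_closed g_lip g_level_bounded.
have sub := gradient_vquad_subsequence OX_open Y_neq0 Y_closed g_lip g_level_bounded
  Y_convex g_C1 g_bounded_below g_convex_mu g_uniform OX_xbar gradient_bounded.
split.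
- by move=> x _; exact: sol_neq0.
- by move=> x mu OXx mu0; exact: (optsol_quad_reg_neq0 OX_open).
- split=> //.
  + by move=> x _; exact: optval_continuous.
  + by move=> mu mu0; exact: vquad_C1.
  + by move=> x OXx; exact: (vquad_cvg OX_open).
split.
  (* Nonemptiness: the constant sequence [xbar] with parameters 1/(k+1) has a subsequence along
     which the gradients converge. *)
  have h0 k : 0 < k.+1%:R^-1 :> R by rewrite invr_gt0.
  have [|f [y [zeta [kf Gf _ _ _]]]] := sub (cst xbar) _ _ h0 cvg_harmonic.
    exact: cvg_cst.
  exists (lsubmx zeta), (cst xbar), (fun k => (f k).+1%:R^-1); split=> //.
    exact: cvg_cst.
  exact: (cvg_comp _ _ (cvg_ge_id kf) cvg_harmonic).
move=> xi [xs [mus [xsx mus0 musc Gxi]]].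
have [f [y [zeta [kf Gf sol_y zetal etaP]]]] := sub _ _ xsx mus0 musc.
(* The gradients already converge to [xi] along the whole sequence, so the extracted limit agrees
   with it. *)
have -> : xi = lsubmx zeta.
  exact: (norm_cvg_unique (cvg_comp _ _ (cvg_ge_id kf) Gxi) Gf).
have [_ /(_ _ zetal) zetaP] := g_consistent (row_mx xbar y).
case: cond_abc => [dg|[_ [rho rho0 wc]]|[_ cvxg]].
- exact: (optval_subdiff_gradient_x sol_neq0 sol_y zetaP (nbhs_singleton Omega_xbar)).
- have yOY : nbhs y OY by apply: open_nbhs_nbhs; split=> //; apply: Y_OY; case: sol_y.
  exact: (optval_subdiff_weakly_concave sol_neq0 sol_y zetaP Omega_xbar yOY cg rho0).
- exact: (optval_subdiff_convex sol_neq0 sol_y zetaP).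
Qed.
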